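(* Let $\Gamma$ be a finite $n$-player extensive-form game with perfect recall (possibly with chance moves). Let $\mathrm{EFCE}$, $\mathrm{EFCCE}$ and $\mathrm{NFCCE}$ denote, respectively, the sets of probability distributions $\mu$ over $\Pi_1\times\dots\times\Pi_n$ that are extensive-form correlated equilibria, extensive-form coarse-correlated equilibria, and normal-form coarse-correlated equilibria of $\Gamma$. Then $$\mathrm{EFCE}\subseteq \mathrm{EFCCE}\subseteq \mathrm{NFCCE}.$$
   Context: **Game.** $\Gamma$ is a finite $n$-player extensive-form game with perfect recall. Each non-leaf node $v$ of the game tree belongs to a player $i\in\{1,\dots,n\}$ or to chance $\mathsf c$ (which plays with fixed known probabilities); $A_v$ is its set of actions. $Z$ is the set of leaves and $u_i(z)\in\mathbb R$ is Player $i$'s payoff at $z\in Z$. The nodes of Player $i$ are partitioned into a collection $\mathcal I_i$ of information sets, with common action set $A_I$ at $I\in\mathcal I_i$. For $z\in Z$, $p_{\mathsf c}(z)$ is the product of the probabilities of chance's actions on the path to $z$ ($=1$ if there are none). **Sequences.** $\Sigma_i=\{(I,a): I\in\mathcal I_i,a\in A_I\}\cup\{\varnothing_i\}$. For a node $v$, $\sigma_i(v)$ is the last $(I,a)\in\Sigma_i$ encountered on the path from the root to $v$ (with $a$ the action taken at $I$ on that path), or $\varnothing_i$ if there is none. For $I\in\mathcal I_i$, $\sigma_i(I)=\sigma_i(v)$ for any $v\in I$ (well defined by perfect recall). **Plans.** A reduced-normal-form plan $\pi$ of Player $i$ selects an action $\pi(I)\in A_I$ at exactly those $I\in\mathcal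 I_i$ that are reachable given the plan's own other choices. $\Pi_i$ is the set of such plans; $\Pi_i(\varnothing_i)=\Pi_i$ and $\Pi_i((I,a))=\Pi_i(\sigma_i(I))\cap\{\pi:\pi(I)=a\}$. Write $\Pi_i(z)=\Pi_i(\sigma_i(z))$ for $z\in Z$ and $\Pi_i(I)=\Pi_i(\sigma_i(I))$ for $I\in\mathcal I_i$. **Equilibria.** Let $\mu$ be a probability distribution over $\Pi_1\times\dots\times\Pi_n$. For $S\subseteq\Pi_i$ and $z\in Z$ put $\mu_i(S;z)=\sum \mu(\pi_1,\dots,\pi_n)$, the sum being over $\pi_i\in S$ and $\pi_j\in\Pi_j(z)$ for all $j\ne i$. Let $u_i(\mu)=\sum_{z\in Z}p_{\mathsf c}(z)u_i(z)\,\mu_i(\Pi_i(z);z)$. For a distribution $\hat\mu$ over plans of Player $i$ put $\hat\mu(z)=\sum_{\pi\in\Pi_i(z)}\hat\mu(\pi)$. For $\hat I\in\mathcal I_i$, $Z_{\hat I}$ is the set of leaves whose path from the root passes through $\hat I$; for $\hat\sigma=(\hat I,\hat a)\in\Sigma_i$, $Z_{\hat\sigma}\subseteq Z_{\hat I}$ is the set of leaves whose path includes playing $\hat a$ at $\hat I$. - $\mu$ is an *NFCCE* if for every player $i$ and every distribution $\hat\mu$ over $\Pi_i$: $\ \sum_{z\in Z}p_{\mathsf c}(z)u_i(z)\,\mu_i(\Pi_i;z)\,\hat\mu(z)\le u_i(\mu)$. - $\mu$ is an *EFCCE* if for every player $i$, $\hat I\in\mathcal I_i$ and distribution $\hat\mu$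 over $\Pi_i(\hat I)$, the utility of the trigger agent that follows all recommendations until reaching $\hat I$ and from then on plays a plan sampled from $\hat\mu$ (independently of $\mu$) is at most $u_i(\mu)$: $\ \sum_{z\in Z_{\hat I}}p_{\mathsf c}(z)u_i(z)\,\mu_i(\Pi_i(\hat I);z)\,\hat\mu(z)+\sum_{z\in Z\setminus Z_{\hat I}}p_{\mathsf c}(z)u_i(z)\,\mu_i(\Pi_i(z);z)\le u_i(\mu)$. - $\mu$ is an *EFCE* if for every player $i$, every $\hat\sigma=(\hat I,\hat a)\in\Sigma_i$ and every distribution $\hat\mu$ over $\Pi_i(\hat I)$, the utility of the trigger agent that follows all recommendations unless it is recommended $\hat a$ at $\hat I$, and in that case plays from $\hat I$ on a plan sampled from $\hat\mu$, is at most $u_i(\mu)$: $\ \sum_{z\in Z_{\hat\sigma}}p_{\mathsf c}(z)u_i(z)\,\mu_i(\Pi_i(\hat\sigma);z)\hat\mu(z)+\sum_{z\in Z_{\hat I}\setminus Z_{\hat\sigma}}p_{\mathsf c}(z)u_i(z)\big[\mu_i(\Pi_i(z);z)+\mu_i(\Pi_i(\hat\sigma);z)\hat\mu(z)\big]+\sum_{z\in Z\setminus Z_{\hat I}}p_{\mathsf c}(z)u_i(z)\,\mu_i(\Pi_i(z);z)\le u_i(\mu)$. *)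

(* Defs.v *)
From HB Require Import structures.
From mathcomp Require Import boolp classical_sets reals.
From mathcomp Require Import all_boot all_order all_algebra finmap.
Set Implicit Arguments. Unset Strict Implicit. Unset Printing Implicit Defensive.
Import Order.TTheory GRing.Theory Num.Theory.
Local Open Scope ring_scope.

Definition acts_at (A : finType) (H : {fset seq A}) (h : seq A) : {set A} :=
  [set a | rcons h a \in H].

(** A node of the game tree is identified with its history, i.e., the sequence
    of actions leading to it from the root [[::]].  A leaf is a node without
    available action.  [owner v = None] means that [v] is a chance node; the
    values of [owner] at leaves, of [payoff] at non-leaves, and of [chance] at
    unavailable actions or nodes not owned by chance are irrelevant. *)
Record game (R : realType) (n : nat) := Game {
  act : finType;
  nodes : {fset seq act};
  owner : nodes -> option 'I_n;
  chance : nodes -> act -> R;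
  infosets : 'I_n -> {set {set nodes}};
  payoff : 'I_n -> nodes -> R;
  root_in_nodes : [::] \in nodes;
  nodes_closed : forall h a, rcons h a \in nodes -> h \in nodes;
  chance_ge0 : forall v a, owner v = None -> a \in acts_at nodes (val v) -> 0 <= chance v a;
  chance_sum1 : forall v, acts_at nodes (val v) != set0 ->
    owner v = None -> \sum_(a in acts_at nodes (val v)) chance v a = 1;
  infosets_partition : forall i, partition (infosets i)
    [set v | (acts_at nodes (val v) != set0) && (owner v == Some i)];
  infosets_acts : forall i (I : {set nodes}), I \in infosets i ->
    {in I &, forall v w, acts_at nodes (val v) = acts_at nodes (val w)}
}.

Section Game.
Context {R : realType} {n : nat} (G : game R n).

Local Notation node := (nodes G).
Local Notation action := (act G).
Local Notation infoset := {set node}.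

Definition acts (v : node) : {set action} := acts_at (nodes G) (val v).

Definition leaves : {set node} := [set v | acts v == set0].

(** [A_I]; the members of an information set all have the same actions. *)
Definition info_acts (I : infoset) : {set action} :=
  [set a | [exists v in I, a \in acts v]].

Fixpoint history_steps (g h : seq action) : seq (seq action * action) :=
  if h is a :: h' then (g, a) :: history_steps (rcons g a) h' else [::].

(** The pairs (node, action taken there) on the path from the root to [v], in
    order, [v] itself excluded.  By [nodes_closed], [insub] never fails. *)
Definition steps (v : node) : seq (node * action) :=
  pmap (fun s => omap (fun w : node => (w, s.2)) (insub s.1))
       (history_steps [::] (val v)).

Definition chance_prob (z : node) : R :=
  \prod_(s <- steps z | owner s.1 == None) chance s.1 s.2.

(** [None] is the empty sequence, [Some (I, a)] the pair [(I, a)]. *)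
Local Notation sequence := (option (infoset * action)).

(** All pairs [(I, a)] of Player [i] encountered on the path to [v]. *)
Definition own_steps (i : 'I_n) (v : node) : seq (infoset * action) :=
  [seq (pblock (infosets G i) s.1, s.2) | s <- steps v & owner s.1 == Some i].

Definition perfect_recall : Prop :=
  forall (i : 'I_n) (I : infoset), I \in infosets G i ->
    {in I &, forall v w, own_steps i v = own_steps i w}.

Definition node_seq (i : 'I_n) (v : node) : sequence :=
  last None (map Some (own_steps i v)).

(** Under perfect recall, the value does not depend on the node picked. *)
Definition info_seq (i : 'I_n) (I : infoset) : sequence :=
  if [pick v in I] is Some v then node_seq i v else None.

Definition reachable (i : 'I_n) (pi : {ffun infoset -> option action})
    (I : infoset) : bool :=
  [exists v in I, all (fun s => pi s.1 == Some s.2) (own_steps i v)].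

(** [pi I = None] means that [pi] selects no action at [I]. *)
Definition is_plan (i : 'I_n) (pi : {ffun infoset -> option action}) : bool :=
  [forall I : infoset,
    if (I \in infosets G i) && reachable i pi I
    then [exists a in info_acts I, pi I == Some a]
    else pi I == None].

Record plan (i : 'I_n) := Plan {
  plan_fun :> {ffun infoset -> option action};
  plan_funP : is_plan i plan_fun }.

HB.instance Definition _ i := [isSub for @plan_fun i].
HB.instance Definition _ i := [Finite of plan i by <:].

Inductive in_plans_of (i : 'I_n) (pi : plan i) : sequence -> Prop :=
| InPlansEmpty : in_plans_of pi None
| InPlansStep (I : infoset) (a : action) :
    in_plans_of pi (info_seq i I) -> pi I = Some a ->
    in_plans_of pi (Some (I, a)).

Definition plans_of (i : 'I_n) (s : sequence) : {set plan i} :=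
  [set pi | `[< in_plans_of pi s >]].

Definition plans_at_node (i : 'I_n) (v : node) : {set plan i} :=
  plans_of i (node_seq i v).

Definition plans_at_info (i : 'I_n) (I : infoset) : {set plan i} :=
  plans_of i (info_seq i I).

Definition profile := {dffun forall i : 'I_n, plan i}.

Definition distribution_over (T : finType) (S : {set T}) (mu : {ffun T -> R}) :=
  [/\ forall x, 0 <= mu x, forall x, x \notin S -> mu x = 0
    & \sum_(x in S) mu x = 1].

Definition leaves_info (I : infoset) : {set node} :=
  [set z in leaves | has (fun s => s.1 \in I) (steps z)].

Definition leaves_seq (I : infoset) (a : action) : {set node} :=
  [set z in leaves | has (fun s => (s.1 \in I) && (s.2 == a)) (steps z)].

(** [mu_i(S; z)] *)
Definition marginal (mu : {ffun profile -> R}) (i : 'I_n) (S : {set plan i})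
    (z : node) : R :=
  \sum_(p : profile | (p i \in S) &&
          [forall j, (j != i) ==> (p j \in plans_at_node j z)]) mu p.

Definition utility (mu : {ffun profile -> R}) (i : 'I_n) : R :=
  \sum_(z in leaves)
    chance_prob z * payoff i z * marginal mu (plans_at_node i z) z.

Definition reach_prob (i : 'I_n) (hmu : {ffun plan i -> R}) (z : node) : R :=
  \sum_(pi in plans_at_node i z) hmu pi.

Definition nfcce_deviation (mu : {ffun profile -> R}) (i : 'I_n)
    (hmu : {ffun plan i -> R}) : R :=
  \sum_(z in leaves)
    chance_prob z * payoff i z * marginal mu [set: plan i] z * reach_prob hmu z.

Definition efcce_deviation (mu : {ffun profile -> R}) (i : 'I_n) (I : infoset)
    (hmu : {ffun plan i -> R}) : R :=
  \sum_(z in leaves_info I)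
    chance_prob z * payoff i z * marginal mu (plans_at_info i I) z
      * reach_prob hmu z
  + \sum_(z in leaves :\: leaves_info I)
      chance_prob z * payoff i z * marginal mu (plans_at_node i z) z.

Definition efce_deviation (mu : {ffun profile -> R}) (i : 'I_n) (I : infoset)
    (a : action) (hmu : {ffun plan i -> R}) : R :=
  \sum_(z in leaves_seq I a)
    chance_prob z * payoff i z * marginal mu (plans_of i (Some (I, a))) z
      * reach_prob hmu z
  + \sum_(z in leaves_info I :\: leaves_seq I a)
      chance_prob z * payoff i z *
      (marginal mu (plans_at_node i z) z
       + marginal mu (plans_of i (Some (I, a))) z * reach_prob hmu z)
  + \sum_(z in leaves :\: leaves_info I)
      chance_prob z * payoff i z * marginal mu (plans_at_node i z) z.

Definition NFCCE : set {ffun profile -> R} := fun mu =>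
  distribution_over [set: profile] mu /\
  forall (i : 'I_n) (hmu : {ffun plan i -> R}),
    distribution_over [set: plan i] hmu ->
    nfcce_deviation mu hmu <= utility mu i.

Definition EFCCE : set {ffun profile -> R} := fun mu =>
  distribution_over [set: profile] mu /\
  forall (i : 'I_n) (I : infoset) (hmu : {ffun plan i -> R}),
    I \in infosets G i ->
    distribution_over (plans_at_info i I) hmu ->
    efcce_deviation mu I hmu <= utility mu i.

Definition EFCE : set {ffun profile -> R} := fun mu =>
  distribution_over [set: profile] mu /\
  forall (i : 'I_n) (I : infoset) (a : action) (hmu : {ffun plan i -> R}),
    I \in infosets G i -> a \in info_acts I ->
    distribution_over (plans_at_info i I) hmu ->
    efce_deviation mu I a hmu <= utility mu i.

End Game.

Arguments NFCCE {R n} G.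
Arguments EFCCE {R n} G.
Arguments EFCE {R n} G.
Arguments perfect_recall {R n} G.

(* Main.v *)
Require Import Defs.
From mathcomp Require Import boolp classical_sets reals.
From mathcomp Require Import all_boot all_order all_algebra finmap.
From mathcomp Require Import ring.
Set Implicit Arguments. Unset Strict Implicit. Unset Printing Implicit Defensive.
Import Order.TTheory GRing.Theory Num.Theory.
Local Open Scope ring_scope.

(** The incentive constraints telescope.  Adding the EFCE constraints of the
    triggers [(I, a)], for [a] ranging over the actions at [I], with the same
    continuation distribution, gives the EFCCE constraint of [I]: the leaves
    below [I] are the disjoint union of those below the [(I, a)], and
    [Pi_i(I)] is the disjoint union of the [Pi_i((I, a))].  Likewise, adding
    the EFCCE constraints of the information sets [I] that the player meets
    first ([sigma_i(I)] empty) gives the NFCCE constraint: these [I] have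
    [Pi_i(I) = Pi_i], the sets of leaves below them are disjoint, and a leaf
    below none of them does not involve the player. *)

(** * Sums over disjoint unions and splittings of lists *)

(** After exchanging the sums, each [t] is counted once, for its only index [s]. *)
Lemma sum_exists_unique (R : nmodType) (S T : finType) (P : pred S)
    (Q : T -> pred S) (F : T -> R) :
  (forall t s s', P s -> P s' -> Q t s -> Q t s' -> s = s') ->
  \sum_(s | P s) \sum_(t | Q t s) F t =
  \sum_(t | [exists s, P s && Q t s]) F t.
Proof.
move=> uniqQ.
rewrite (exchange_big_dep (fun t => [exists s, P s && Q t s])) /=; last first.
  by move=> s t Ps Qts; apply/existsP; exists s; rewrite Ps.
apply: eq_bigr => t /existsP[s0 /andP[Ps0 Qts0]].
rewrite (big_pred1 s0) // => s /=; apply/andP/eqP => [[Ps Qts]|->] //.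
exact: uniqQ Qts Qts0.
Qed.

(** Serves to lift a splitting of [own_steps] to one of [steps]. *)
Lemma map_filter_cat (S T : Type) (f : S -> T) (p : pred S) s t1 x t2 :
  [seq f y | y <- s & p y] = t1 ++ x :: t2 ->
  exists u1 y u2, [/\ s = u1 ++ y :: u2, p y, f y = x &
    [seq f y | y <- u1 & p y] = t1].
Proof.
elim: s t1 => [|y s IH] t1 /=; first by case: t1.
case: ifPn => [py|/negPf npy].
  case: t1 => [[<- _]|x1 t1 [<- /IH[u1 [y' [u2 [-> py' <- <-]]]]]].
    by exists [::], y, s.
  by exists (y :: u1), y', u2; rewrite /= py.
move=> /IH[u1 [y' [u2 [-> py' <- <-]]]].
by exists (y :: u1), y', u2; rewrite /= npy.
Qed.

Lemma mem_cat_cons (T : eqType) (x : T) s :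
  x \in s -> exists t1 t2, s = t1 ++ x :: t2.
Proof. by case/splitPr=> t1 t2; exists t1, t2. Qed.

Section Game.
Context {R : realType} {n : nat} (G : game R n).

Local Notation node := (nodes G).
Local Notation action := (act G).
Local Notation infoset := {set node}.

(** * Paths in the game tree *)

Lemma history_steps_rcons (g h : seq action) (a : action) :
  history_steps g (rcons h a) = rcons (history_steps g h) (g ++ h, a).
Proof.
elim: h g => [|b h IH] g /=; first by rewrite cats0.
by rewrite IH cat_rcons.
Qed.

Lemma steps_root (v : node) : val v = [::] -> steps v = [::].
Proof. by rewrite /steps => ->. Qed.

Lemma steps_rcons (v w : node) (a : action) :
  val v = rcons (val w) a -> steps v = rcons (steps w) (w, a).
Proof.
rewrite /steps => ->; rewrite history_steps_rcons -!cats1 pmap_cat /=.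
by rewrite valK.
Qed.

(** Induction on the length of the history: either [s] is the last step, taken at the parent of [z],
    or the claim is inherited from that parent. *)
Lemma steps_cat (z : node) (s : node * action) t1 t2 :
  steps z = t1 ++ s :: t2 -> t1 = steps s.1 /\ s.2 \in acts s.1.
Proof.
have [k] := ubnP (size (val z)); elim: k => // k IH in z t2 *.
case val_z: _ / (lastP (val z)) => [|g a] z_k.
  by rewrite (steps_root val_z); case: (t1).
have g_node : g \in nodes G.
  by apply: (@nodes_closed _ _ G g a); rewrite -val_z (valP z).
rewrite (@steps_rcons z (FSetSub g_node) a val_z).
case/lastP: t2 => [|t2 x].
  rewrite cats1 => /rcons_inj[<- <-] /=; split=> //.
  by rewrite inE /= -val_z (valP z).
rewrite -rcons_cons -rcons_cat => /rcons_inj[def_g _]; apply: IH def_g.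
by move: z_k; rewrite size_rcons ltnS.
Qed.

Section Player.
Variable i : 'I_n.

(** * Information sets along a path *)

Lemma infosetP (I : infoset) (v : node) : I \in infosets G i -> v \in I ->
  owner v = Some i /\ pblock (infosets G i) v = I.
Proof.
move=> I_i v_I; have /and3P[/eqP cov triv _] := @infosets_partition _ _ G i.
split; last exact: def_pblock.
have: v \in cover (infosets G i) by apply/bigcupP; exists I.
by rewrite cov inE => /andP[_ /eqP].
Qed.

Lemma infoset_neq0 (I : infoset) : I \in infosets G i -> I != set0.
Proof.
move=> I_i; have /and3P[_ _ not0] := @infosets_partition _ _ G i.
by apply: contraNneq not0 => <-.
Qed.

(** Exhibits what precedes [(I, a)] as the own steps of a node of [I], the form to which perfect
    recall applies. *)
Lemma own_steps_cat (z : node) (I : infoset) (a : action) t1 t2 :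
  own_steps i z = t1 ++ (I, a) :: t2 ->
  [/\ I \in infosets G i, a \in info_acts I &
    exists2 v, v \in I & own_steps i v = t1].
Proof.
move=> def_z; have [u1 [[v b] [u2 []]]] := map_filter_cat def_z.
move=> /steps_cat[/= -> b_v] v_i [<- <-] <-.
have /and3P[/eqP cov triv _] := @infosets_partition _ _ G i.
have v_cov : v \in cover (infosets G i).
  by rewrite cov inE v_i andbT; apply/set0Pn; exists b.
have v_I : v \in pblock (infosets G i) v by rewrite mem_pblock.
split; [exact: pblock_mem | | by exists v].
by rewrite inE; apply/existsP; exists v; rewrite v_I.
Qed.

(** Since [I] is a block of the partition, a step at a node of [I] is recorded in [own_steps] under
    [I] itself. Disjointness of sets of leaves thus becomes a question about own steps. *)
Lemma leaves_seqE (I : infoset) (a : action) (z : node) :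
  I \in infosets G i ->
  (z \in leaves_seq I a) = (z \in leaves G) && ((I, a) \in own_steps i z).
Proof.
move=> I_i; rewrite inE; congr (_ && _); apply/hasP/idP.
  case=> -[v b] v_z /= /andP[v_I /eqP <-].
  have [v_i def_I] := infosetP I_i v_I.
  by apply/mapP; exists (v, b); rewrite ?def_I // mem_filter /= v_i eqxx.
case/mapP => -[v b]; rewrite mem_filter /= => /andP[/eqP v_i v_z] [def_I ->].
exists (v, b) => //=; rewrite eqxx andbT def_I mem_pblock.
have [t1 [t2 /steps_cat[_ /= b_v]]] := mem_cat_cons v_z.
have /and3P[/eqP -> _ _] := @infosets_partition _ _ G i.
by rewrite inE v_i eqxx andbT; apply/set0Pn; exists b.
Qed.

Lemma sub_leaves_seq (I : infoset) (a : action) :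
  leaves_seq I a \subset leaves_info I.
Proof.
apply/fintype.subsetP => z; rewrite !inE => /andP[-> /hasP[s s_z /andP[s_I _]]].
by apply/hasP; exists s.
Qed.

Lemma leaves_infoE (I : infoset) (z : node) :
  (z \in leaves_info I) = [exists a in info_acts I, z \in leaves_seq I a].
Proof.
apply/setIdP/existsP => [[z_leaf /hasP[[v a] v_z /= v_I]]|[a /andP[_ z_Ia]]].
  exists a; have [t1 [t2 /steps_cat[_ /= a_v]]] := mem_cat_cons v_z.
  apply/andP; split; first by rewrite inE; apply/existsP; exists v; rewrite v_I.
  by apply/setIdP; split=> //; apply/hasP; exists (v, a); rewrite //= v_I eqxx.
have := fintype.subsetP (sub_leaves_seq I a) z z_Ia; exact/setIdP.
Qed.

Lemma sub_leaves_info (I : infoset) : leaves_info I \subset leaves G.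
Proof. by apply/fintype.subsetP => z; rewrite inE => /andP[]. Qed.

Lemma sum_leaves_split (A B : {set node}) (F : node -> R) : A \subset B ->
  \sum_(z in B) F z = \sum_(z in A) F z + \sum_(z in B :\: A) F z.
Proof. by move=> /finset.setIidPr AB; rewrite (big_setID A) AB. Qed.

(** * Consequences of perfect recall *)

Hypothesis HG : perfect_recall G.

(** For [I = J], this excludes absent-mindedness. *)
Lemma own_steps_inj (z v w : node) (I J : infoset) (a b : action) :
  v \in I -> w \in J -> own_steps i v = own_steps i w ->
  (I, a) \in own_steps i z -> (J, b) \in own_steps i z -> (I, a) = (J, b).
Proof.
move=> v_I w_J vw /mem_cat_cons[t1 [t2 def_z]] /mem_cat_cons[t3 [t4]].
move=> def_z'; have [I_i _ [v' v'_I def_t1]] := own_steps_cat def_z.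
have [J_i _ [w' w'_J def_t3]] := own_steps_cat def_z'.
(* The prefixes before the two pairs are own steps of nodes of [I] and of [J], hence equal by
   perfect recall and [vw]. The pairs therefore sit at the same position. *)
move/eqP: def_z; rewrite def_z' -def_t1 -def_t3.
rewrite (HG I_i v'_I v_I) (HG J_i w'_J w_J) vw.
by rewrite eqseq_cat // eqxx /= => /eqP[-> ->].
Qed.

Lemma info_seqE (I : infoset) (v : node) :
  I \in infosets G i -> v \in I -> info_seq i I = node_seq i v.
Proof.
move=> I_i v_I; rewrite /info_seq; case: pickP => [w w_I|/(_ v)].
  by rewrite /node_seq (HG I_i w_I v_I).
by rewrite v_I.
Qed.

Lemma own_steps_first (v : node) (I : infoset) : I \in infosets G i ->
  v \in I -> info_seq i I = None -> own_steps i v = [::].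
Proof.
move=> I_i v_I; rewrite (info_seqE I_i v_I) /node_seq.
by case: (lastP (own_steps i v)) => // s x; rewrite map_rcons last_rcons.
Qed.

Lemma own_steps_head (z : node) (I : infoset) (a : action) t :
  own_steps i z = (I, a) :: t -> info_seq i I = None.
Proof.
move=> /(@own_steps_cat _ _ _ [::])[I_i _ [v v_I def_v]].
by rewrite (info_seqE I_i v_I) /node_seq def_v.
Qed.

(** Links the recursive definition of [Pi_i(v)] to the path condition in [reachable]: the own steps
    before the last pair [(I, a)] are those of a node of [I], where induction applies. *)
Lemma in_plans_of_own_steps (pi : plan G i) (v : node) :
  in_plans_of pi (node_seq i v) ->
  all (fun s => pi s.1 == Some s.2) (own_steps i v).
Proof.
have [k] := ubnP (size (own_steps i v)); elim: k => // k IH in v *.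
rewrite /node_seq; case def_v: _ / (lastP (own_steps i v)) => [//|s [I a]].
rewrite size_rcons ltnS map_rcons last_rcons => s_k pi_Ia.
have [pi_I pi_a] : in_plans_of pi (info_seq i I) /\ pi I = Some a.
  by inversion pi_Ia.
rewrite all_rcons /= pi_a eqxx /=.
have [|I_i _ [w w_I def_w]] := @own_steps_cat v I a s [::].
  by rewrite cats1.
by rewrite -def_w; apply: IH; rewrite ?def_w // -(info_seqE I_i w_I).
Qed.

(** A plan in [Pi_i(I)] makes [I] reachable, so [is_plan] forces it to select an action there. *)
Lemma plans_of_info_acts (pi : plan G i) (I : infoset) : I \in infosets G i ->
  (pi \in plans_at_info i I) =
  [exists a in info_acts I, pi \in plans_of i (Some (I, a))].
Proof.
move=> I_i; apply/idP/existsP => [|[a /andP[_]]]; rewrite !inE; last first.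
  by move=> /asboolP pi_Ia; apply/asboolP; inversion pi_Ia.
move=> /asboolP pi_I; have /set0Pn[v v_I] := infoset_neq0 I_i.
have /forallP/(_ I) := plan_funP pi.
have -> : reachable i pi I.
  apply/existsP; exists v; rewrite v_I; apply: in_plans_of_own_steps.
  by rewrite -(info_seqE I_i v_I).
rewrite I_i /= => /existsP[a /andP[a_I /eqP pi_a]]; exists a.
by rewrite a_I inE; apply/asboolP; constructor.
Qed.

Lemma plans_of_action (pi : plan G i) (I : infoset) (a : action) :
  pi \in plans_of i (Some (I, a)) -> pi I = Some a.
Proof. by rewrite inE => /asboolP pi_Ia; inversion pi_Ia. Qed.

Lemma marginal_info_acts (mu : {ffun profile G -> R}) (I : infoset) (z : node) :
  I \in infosets G i ->
  \sum_(a in info_acts I) marginal mu (plans_of i (Some (I, a))) z =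
  marginal mu (plans_at_info i I) z.
Proof.
move=> I_i; rewrite /marginal sum_exists_unique; last first.
  move=> p a b _ _ /andP[/plans_of_action pa _] /andP[/plans_of_action pb _].
  by move: pa; rewrite pb => -[].
apply: eq_bigl => p; rewrite plans_of_info_acts //.
apply/existsP/andP => [[a /and3P[a_I pa pz]]|[/existsP[a /andP[a_I pa]] pz]].
  by split=> //; apply/existsP; exists a; rewrite a_I.
by exists a; rewrite a_I pa.
Qed.

(** * Decompositions of the sets of leaves *)

Lemma sum_leaves_seq (F : node -> R) (I : infoset) : I \in infosets G i ->
  \sum_(a in info_acts I) \sum_(z in leaves_seq I a) F z =
  \sum_(z in leaves_info I) F z.
Proof.
move=> I_i; have /set0Pn[v v_I] := infoset_neq0 I_i.
rewrite sum_exists_unique => [|z a b _ _].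
  by apply: eq_bigl => z; rewrite leaves_infoE.
rewrite !leaves_seqE // => /andP[_ a_z] /andP[_ b_z].
by case: (own_steps_inj v_I v_I (erefl _) a_z b_z).
Qed.

Definition first_infosets : {set infoset} :=
  [set I in infosets G i | info_seq i I == None].

Lemma leaf_below_first (z : node) : z \in leaves G ->
  [exists I in first_infosets, z \in leaves_info I] = (own_steps i z != [::]).
Proof.
move=> z_leaf; apply/existsP/idP => [[I /andP[]]|].
  rewrite inE => /andP[I_i _]; rewrite leaves_infoE => /existsP[a /andP[_]].
  by rewrite leaves_seqE // => /andP[_]; case: (own_steps i z).
case def_z: (own_steps i z) => [//|[I a] t] _.
have [I_i a_I _] := @own_steps_cat z I a [::] t def_z.
exists I; rewrite inE I_i (own_steps_head def_z) leaves_infoE.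
by apply/existsP; exists a; rewrite a_I leaves_seqE // z_leaf def_z mem_head.
Qed.

Lemma sum_leaves_first (F : node -> R) :
  \sum_(I in first_infosets) \sum_(z in leaves_info I) F z =
  \sum_(z in leaves G | own_steps i z != [::]) F z.
Proof.
rewrite sum_exists_unique => [|z I J].
  apply: eq_bigl => z; have [z_leaf|z_inner] /= := boolP (z \in leaves G).
    exact: leaf_below_first.
  apply/existsP => -[I /andP[_ z_I]].
  by case/negP: z_inner; apply: (fintype.subsetP (sub_leaves_info I)).
case/setIdP=> I_i /eqP I_None /setIdP[J_i /eqP J_None].
have [/set0Pn[v v_I] /set0Pn[w w_J]] := (infoset_neq0 I_i, infoset_neq0 J_i).
(* Both information sets are met before any own move, so [own_steps_inj] applies to them. *)
have vw : own_steps i v = own_steps i w.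
  by rewrite (own_steps_first I_i v_I) ?(own_steps_first J_i w_J).
rewrite !leaves_infoE => /existsP[a /andP[_ z_Ia]] /existsP[b /andP[_ z_Jb]].
move: z_Ia z_Jb; rewrite !leaves_seqE // => /andP[_ Ia_z] /andP[_ Jb_z].
by case: (own_steps_inj v_I w_J vw Ia_z Jb_z).
Qed.

(** * Gains from deviating, and their sums *)

(** The obedient terms outside [leaves_seq I a] cancel. In the first remaining sum only the marginal
    depends on [a], in the second only the range of leaves, so both can be added up over [a]. *)
Lemma efce_gainE (mu : {ffun profile G -> R}) (I : infoset) (a : action)
    (hmu : {ffun plan G i -> R}) :
  efce_deviation mu I a hmu - utility mu i =
  \sum_(z in leaves_info I) chance_prob z * payoff i z *
      (marginal mu (plans_of i (Some (I, a))) z * reach_prob hmu z)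
  - \sum_(z in leaves_seq I a)
      chance_prob z * payoff i z * marginal mu (plans_at_node i z) z.
Proof.
rewrite /efce_deviation /utility.
rewrite (sum_leaves_split _ (sub_leaves_info I)).
rewrite !(sum_leaves_split _ (sub_leaves_seq I a)).
under [X in _ + X + _]eq_bigr do rewrite mulrDr.
under [X in X + _ + _]eq_bigr do rewrite -mulrA.
rewrite big_split /=; ring.
Qed.

Lemma efcce_gainE (mu : {ffun profile G -> R}) (I : infoset)
    (hmu : {ffun plan G i -> R}) :
  efcce_deviation mu I hmu - utility mu i =
  \sum_(z in leaves_info I) chance_prob z * payoff i z *
      (marginal mu (plans_at_info i I) z * reach_prob hmu z
       - marginal mu (plans_at_node i z) z).
Proof.
rewrite /efcce_deviation /utility (sum_leaves_split _ (sub_leaves_info I)).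
rewrite opprD addrACA subrr addr0 -sumrB.
by apply: eq_bigr => z _; rewrite mulrBr mulrA.
Qed.

Lemma sum_efce_gain (mu : {ffun profile G -> R}) (I : infoset)
    (hmu : {ffun plan G i -> R}) : I \in infosets G i ->
  \sum_(a in info_acts I) (efce_deviation mu I a hmu - utility mu i) =
  efcce_deviation mu I hmu - utility mu i.
Proof.
move=> I_i; under eq_bigr do rewrite efce_gainE.
rewrite sumrB sum_leaves_seq // exchange_big -sumrB efcce_gainE.
apply: eq_bigr => z _; rewrite mulrBr; congr (_ - _).
by rewrite -mulr_sumr -mulr_suml marginal_info_acts.
Qed.

Lemma plans_of_None : plans_of i None = [set: plan G i].
Proof. by apply/setP => pi; rewrite !inE; apply/asboolP; constructor. Qed.

Lemma sum_efcce_gain (mu : {ffun profile G -> R}) (hmu : {ffun plan G i -> R}) :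
  distribution_over [set: plan G i] hmu ->
  \sum_(I in first_infosets) (efcce_deviation mu I hmu - utility mu i) =
  nfcce_deviation mu hmu - utility mu i.
Proof.
case=> _ _ hmu1.
transitivity (\sum_(I in first_infosets) \sum_(z in leaves_info I)
    chance_prob z * payoff i z * (marginal mu [set: plan G i] z
      * reach_prob hmu z - marginal mu (plans_at_node i z) z)).
  apply: eq_bigr => I; rewrite inE => /andP[_ /eqP I_None].
  by rewrite efcce_gainE /plans_at_info I_None plans_of_None.
rewrite sum_leaves_first /nfcce_deviation /utility -sumrB big_mkcondr.
apply: eq_bigr => z _; have [def_z|_] /= := eqVneq (own_steps i z) [::].
  (* All plans reach a leaf without own steps: [reach_prob hmu z] is the total mass 1 and deviating
     gains nothing there. *)
  rewrite /reach_prob /plans_at_node /node_seq def_z plans_of_None hmu1.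
  by rewrite mulr1 subrr.
by rewrite mulrBr mulrA.
Qed.

End Player.
End Game.

Local Open Scope classical_set_scope.

Theorem proposition5 (R : realType) (n : nat) (G : game R n)
    (HG : perfect_recall G) :
  EFCE G `<=` EFCCE G /\ EFCCE G `<=` NFCCE G.
Proof.
split=> mu [mu_distr mu_eq]; split=> // i.
  move=> I hmu I_i hmu_distr; rewrite -subr_le0 -(sum_efce_gain HG) //.
  by apply: sumr_le0 => a a_I; rewrite subr_le0 mu_eq.
move=> hmu hmu_distr; rewrite -subr_le0 -(sum_efcce_gain HG) //.
apply: sumr_le0 => I; rewrite inE => /andP[I_i /eqP I_None].
(* As [sigma_i(I)] is empty, [hmu] is also a distribution over [Pi_i(I)], hence an admissible
   continuation at [I]. *)
by rewrite subr_le0 mu_eq // /plans_at_info I_None plans_of_None.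
Qed.
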